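(* The real number $\zeta(3)=\sum_{n=1}^{\infty}\frac{1}{n^3}$ is irrational.
   Context: $\zeta(s)=\sum_{n=1}^{\infty} n^{-s}$ denotes the Riemann zeta function (for real $s>1$). *)

(* Defs.v *)
From HB Require Import structures.
From mathcomp Require Import all_boot all_order all_algebra.
From mathcomp Require Import all_classical all_reals all_analysis.
From mathcomp Require Import ring lra.

Set Implicit Arguments.
Unset Strict Implicit.
Unset Printing Implicit Defensive.

Import Order.TTheory GRing.Theory Num.Theory.
Import numFieldNormedType.Exports.

Local Open Scope classical_set_scope.
Local Open Scope ring_scope.

(* The sum over n >= 1 is indexed from 0, whence [n.+1].  As [limn] is total,
   [zeta s] is meaningful only when the series converges, i.e., for s > 1. *)
Definition zeta (R : realType) (s : R) : R :=
  limn (series (fun n : nat => n.+1%:R `^ (- s))).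

Lemma zeta3_coeffE (R : realType) :
  (fun n : nat => n.+1%:R `^ (- 3)) = (fun n => 1 / n.+1%:R ^+ 3) :> (R ^nat).
Proof. by apply/funext => n; rewrite powRN powR_mulrn ?ler0n// div1r. Qed.

Lemma is_cvg_series_zeta3 (R : realType) :
  cvgn (series (fun n : nat => 1 / n.+1%:R ^+ 3 : R)).
Proof.
have ge0 n : 0 <= 1 / n.+1%:R ^+ 3 :> R by rewrite divr_ge0// exprn_ge0.
have nd : nondecreasing_seq (series (fun n : nat => 1 / n.+1%:R ^+ 3 : R)).
  by apply/nondecreasing_seqP => n; rewrite /series /= big_nat_recr//= lerDl.
apply: nondecreasing_is_cvgn => //.
exists 2 => _ [n _ <-]; apply: le_trans (nd _ _ (leqnSn n)) _.
apply: (@le_trans _ _ (2 - 1 / n.+1%:R)); last by rewrite gerBl divr_ge0.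
elim: n => [|n ih]; first by rewrite /series /= big_nat1; lra.
rewrite /series /= big_nat_recr//=.
apply: le_trans (lerD ih (lexx _)) _.
rewrite -(natr1 n.+1); set x : R := n.+1%:R.
have x1 : 1 <= x by rewrite ler1n.
rewrite -subr_ge0.
have -> : 2 - 1 / (x + 1) - (2 - 1 / x + 1 / (x + 1) ^+ 3) =
  (x ^+ 2 + x + 1) / (x * (x + 1) ^+ 3) by field; apply/andP; split; lra.
by rewrite divr_ge0// ?mulr_ge0 ?exprn_ge0//; nra.
Qed.

Lemma cvg_zeta3 (R : realType) :
  series (fun n : nat => 1 / n.+1%:R ^+ 3) @ \oo --> zeta (3 : R).
Proof. by rewrite /zeta zeta3_coeffE; exact: is_cvg_series_zeta3. Qed.

(* Main.v *)
(* Apery's proof.  With h(n,k) = C(n,k) C(n+k,k), put b_n = sum_k h(n,k)^2 and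
   a_n = sum_k h(n,k)^2 c(n,k), where c(n,k) is the n-th partial sum of zeta(3)
   plus a correction of size O(1/n), so that a_n / b_n tends to zeta(3).  Both
   sequences satisfy
     (n+1)^3 x_{n+1} - (34n^3 + 51n^2 + 27n + 5) x_n + n^3 x_{n-1} = 0
   (Zagier's telescoping certificates), whence
   a_{n+1} b_n - a_n b_{n+1} = 6 / (n+1)^3 and 0 < b_n zeta(3) - a_n = O(1/b_n).
   The recurrence also gives b_n >= 33^n up to a constant.  On the other hand
   2 L_n^3 a_n is an integer for L_n = lcm(1, ..., n), and a Chebyshev-type
   estimate gives L_n = O(3.2^n).  Since 3.2^3 < 33, a rational zeta(3) would
   produce positive integers tending to 0. *)
Require Import Defs.
From mathcomp Require Import all_boot all_order all_algebra.
From mathcomp Require Import all_classical all_reals all_analysis.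
From mathcomp Require Import zify ring lra.

Set Implicit Arguments.
Unset Strict Implicit.
Unset Printing Implicit Defensive.

Import Order.TTheory GRing.Theory Num.Theory.
Import numFieldNormedType.Exports.

(** * The least common multiple of the first integers *)

Definition lcm_upto (n : nat) : nat := \big[lcmn/1%N]_(i < n) i.+1.

Lemma lcm_uptoS n : lcm_upto n.+1 = lcmn (lcm_upto n) n.+1.
Proof. by rewrite /lcm_upto big_ord_recr. Qed.

Lemma lcm_upto_gt0 n : 0 < lcm_upto n.
Proof.
by elim: n => [|n ih]; rewrite ?lcm_uptoS ?lcmn_gt0 ?ih // /lcm_upto big_ord0.
Qed.

Lemma dvdn_lcm_upto i n : 0 < i <= n -> i %| lcm_upto n.
Proof.
case: i => // i /= lt_in.
by rewrite (biglcmn_sup (Ordinal lt_in)).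
Qed.

Lemma dvdn_lcm_upto_leq m n : m <= n -> lcm_upto m %| lcm_upto n.
Proof.
move=> le_mn; apply/dvdn_biglcmP => i _; apply: dvdn_lcm_upto.
by rewrite (leq_trans (ltn_ord i)).
Qed.

(** * The Chebyshev quotient and the bound on lcm(1, ..., n) *)

(* Equals (42m)! / ((21m)! (14m)! (6m)! m!). *)
Definition cheb42 (m : nat) : nat :=
  'C(42 * m, 21 * m) * 'C(21 * m, 14 * m) * 'C(7 * m, 6 * m).

Lemma cheb42_fact m :
  cheb42 m * ((21 * m)`! * (14 * m)`! * (6 * m)`! * m`!) = (42 * m)`!.
Proof.
have h1 : 21 * m <= 42 * m by lia.
have h2 : 14 * m <= 21 * m by lia.
have h3 : 6 * m <= 7 * m by lia.
have /esym := bin_fact h1; have /esym := bin_fact h2; have /esym := bin_fact h3.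
rewrite (_ : 42 * m - 21 * m = 21 * m); last by lia.
rewrite (_ : 21 * m - 14 * m = 7 * m); last by lia.
rewrite (_ : 7 * m - 6 * m = m); last by lia.
rewrite /cheb42 => e3 e2 e1; rewrite e1 [X in _ = _ * (_ * X)]e2 e3.
by ring.
Qed.

Lemma cheb42_gt0 m : 0 < cheb42 m.
Proof. by rewrite /cheb42 !muln_gt0 !bin_gt0; lia. Qed.

Lemma bin_mul_exp_leq n k a b : k <= n ->
  'C(n, k) * (a ^ (n - k) * b ^ k) <= (a + b) ^ n.
Proof.
move=> le_kn; rewrite expnDn.
have lt_kn : k < n.+1 by [].
by rewrite (bigD1 (Ordinal lt_kn)) //= leq_addr.
Qed.

(** Each binomial is bounded through one term of (a + b)^n with a : b = n - k : k, a choice sharp up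
    to a polynomial factor. The constant is 2^42 3^21 7^7 / (2^14 6^6). *)
Lemma cheb42_leq m : cheb42 m <= (2 ^ 22 * 3 ^ 15 * 7 ^ 7) ^ m.
Proof.
have h1 : 21 * m <= 42 * m by lia.
have h2 : 14 * m <= 21 * m by lia.
have h3 : 6 * m <= 7 * m by lia.
have H1 : 'C(42 * m, 21 * m) <= 2 ^ (42 * m).
  by have := bin_mul_exp_leq 1 1 h1; rewrite !exp1n !muln1.
have H2 : 'C(21 * m, 14 * m) * 2 ^ (14 * m) <= 3 ^ (21 * m).
  by have := bin_mul_exp_leq 1 2 h2; rewrite exp1n mul1n.
have H3 : 'C(7 * m, 6 * m) * 6 ^ (6 * m) <= 7 ^ (7 * m).
  by have := bin_mul_exp_leq 1 6 h3; rewrite exp1n mul1n.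
have e6 : 6 ^ (6 * m) = 2 ^ (6 * m) * 3 ^ (6 * m) by rewrite -expnMn.
have := leq_mul (leq_mul H1 H2) H3.
have -> : 2 ^ (42 * m) * 3 ^ (21 * m) * 7 ^ (7 * m) =
  (2 ^ 22 * 3 ^ 15 * 7 ^ 7) ^ m * (2 ^ (14 * m) * 6 ^ (6 * m)).
  have expnM3 a b c :
      (a ^ 22 * b ^ 15 * c ^ 7) ^ m = a ^ (22 * m) * b ^ (15 * m) * c ^ (7 * m).
    by rewrite 2!expnMn (expnM a) (expnM b) (expnM c).
  rewrite e6 expnM3.
  rewrite (_ : 42 * m = 22 * m + 14 * m + 6 * m); last by lia.
  rewrite (_ : 21 * m = 15 * m + 6 * m); last by lia.
  rewrite !expnD; move: (2 ^ (22 * m)) (2 ^ (14 * m)) (2 ^ (6 * m)) => x y z.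
  by move: (3 ^ (15 * m)) (3 ^ (6 * m)) (7 ^ (7 * m)) => u v w; ring.
have -> : 'C(42 * m, 21 * m) * ('C(21 * m, 14 * m) * 2 ^ (14 * m)) *
  ('C(7 * m, 6 * m) * 6 ^ (6 * m)) = cheb42 m * (2 ^ (14 * m) * 6 ^ (6 * m)).
  by rewrite /cheb42; move: (2 ^ (14 * m)) (6 ^ (6 * m)) => x y; ring.
by rewrite leq_pmul2r // muln_gt0 !expn_gt0.
Qed.

Lemma sum_nat_widen0 (F : nat -> nat) n N : n <= N ->
  (forall k, n < k -> F k = 0) ->
  \sum_(1 <= k < n.+1) F k = \sum_(1 <= k < N.+1) F k.
Proof.
move=> le_nN F0; rewrite (big_cat_nat _ (n := n.+1) (p := N.+1)) //=.
rewrite [X in _ = _ + X]big_nat_cond [X in _ = _ + X]big1 ?addn0 // => k.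
by case/andP=> /andP[/F0].
Qed.

(** Legendre's formula with a common range N, so that the sums for the factorials of [cheb42_fact]
    merge termwise. *)
Lemma logn_fact_leq p n N : prime p -> n <= N ->
  logn p n`! = \sum_(1 <= k < N.+1) n %/ p ^ k.
Proof.
move=> pp le_nN; rewrite logn_fact //; apply: sum_nat_widen0 => // k lt_nk.
by rewrite divn_small // (ltn_trans lt_nk) // ltn_expl // prime_gt1.
Qed.

(* As 1 = 1/2 + 1/3 + 1/7 + 1/42, for 1 <= x < 42 the integer floor x exceeds
   floor (x/2) + floor (x/3) + floor (x/7) + floor (x/42). *)
Lemma divn42_leq m q : 0 < q ->
  (21 * m) %/ q + (14 * m) %/ q + (6 * m) %/ q + m %/ q + (m < q <= 42 * m)
    <= (42 * m) %/ q.
Proof.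
move=> q0; set N := (42 * m) %/ q.
(* Nested floors: for a b = 42, floor(a m / q) = floor(N / b), so everything depends on N alone. *)
have red a b : a * b = 42 -> 0 < b -> (a * m) %/ q = N %/ b.
  by move=> ab b0; rewrite /N -divnMA -ab (mulnC a b) -mulnA (mulnC q) divnMl.
rewrite (red 21 2) // (red 14 3) // (red 6 7) //.
have -> : m %/ q = N %/ 42 by rewrite -(red 1 42) // mul1n.
have : (m < q <= 42 * m) -> 0 < N < 42.
  by case/andP=> mq qm; rewrite /N divn_gt0 // qm ltn_divLR //; lia.
by case: (m < q <= 42 * m) => [/(_ isT)|_]; lia.
Qed.

(** By Legendre's formula and [divn42_leq], each k with m < p^k <= 42 m adds at least 1 to the
    valuation of [cheb42 m]; the exponents from b + 1 to a are such. *)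
Lemma logn_cheb42_ge p m a b : prime p -> m < p ^ b.+1 -> p ^ a <= 42 * m ->
  a <= logn p (cheb42 m) + b.
Proof.
move=> pp lt_m le_a.
move: (cheb42 m) (cheb42_gt0 m) (cheb42_fact m) => D D0 /(congr1 (logn p)).
rewrite !lognM ?muln_gt0 ?fact_gt0 ?D0 //.
rewrite !(@logn_fact_leq p _ (42 * m)) //; try lia.
rewrite -!big_split /= => eqD.
have : \sum_(1 <= k < (42 * m).+1)
      ((21 * m) %/ p ^ k + (14 * m) %/ p ^ k + (6 * m) %/ p ^ k + m %/ p ^ k)
    + \sum_(1 <= k < (42 * m).+1) (m < p ^ k <= 42 * m)
    <= \sum_(1 <= k < (42 * m).+1) ((42 * m) %/ p ^ k).
  rewrite -big_split /=; apply: leq_sum => k _.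
  by apply: divn42_leq; rewrite expn_gt0 prime_gt0.
rewrite -eqD [X in _ <= X]addnC leq_add2l => le_D.
case: (leqP a b) => [le_ab|lt_ba]; first by rewrite (leq_trans le_ab) ?leq_addl.
rewrite addnC -leq_subLR.
apply: leq_trans le_D.
have p1 := prime_gt1 pp.
have lt_a : a < (42 * m).+1 by rewrite ltnS (leq_trans _ le_a) // ltnW // ltn_expl.
rewrite (big_cat_nat _ (n := b.+1)) //=; last by lia.
rewrite (big_cat_nat _ (n := a.+1) (m := b.+1)) //=; last by lia.
rewrite addnCA; apply: leq_trans (leq_addr _ _).
have -> : a - b = \sum_(b.+1 <= k < a.+1) 1 by rewrite sum_nat_const_nat muln1 subSS.
rewrite big_nat [X in _ <= X]big_nat; apply: leq_sum => k /andP[bk ka].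
rewrite lt0b; apply/andP; split; last first.
  by rewrite (leq_trans _ le_a) // leq_pexp2l // ltnW.
by rewrite (leq_trans lt_m) // leq_pexp2l // ltnW.
Qed.

(** Prime by prime: lcm(1, ..., m) supplies the exponent [trunc_log p m], and [cheb42 m] supplies
    the rest. *)
Lemma lcm_upto42_dvd m : lcm_upto (42 * m) %| cheb42 m * lcm_upto m.
Proof.
case: (posnP m) => [->|m0].
  by rewrite muln0 dvdn_mull.
apply/dvdn_biglcmP => i _; set j := i.+1.
have le_j : j <= 42 * m := ltn_ord i.
have D0 : 0 < cheb42 m * lcm_upto m by rewrite muln_gt0 cheb42_gt0 lcm_upto_gt0.
apply/dvdn_partP => // p; rewrite mem_primes => /and3P[pp _ _].
rewrite p_part pfactor_dvdn // lognM ?cheb42_gt0 ?lcm_upto_gt0 //.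
have p1 := prime_gt1 pp.
apply: (@leq_trans (logn p (cheb42 m) + trunc_log p m)).
  apply: logn_cheb42_ge => //; first exact: trunc_log_ltn.
  by rewrite (leq_trans _ le_j) // dvdn_leq // pfactor_dvdnn.
rewrite leq_add2l -pfactor_dvdn ?lcm_upto_gt0 // dvdn_lcm_upto //.
by rewrite trunc_logP // expn_gt0 prime_gt0.
Qed.

Lemma lcm_upto_leq m n : m <= n -> lcm_upto m <= lcm_upto n.
Proof. by move=> le_mn; rewrite dvdn_leq ?lcm_upto_gt0 ?dvdn_lcm_upto_leq. Qed.

(** The existential keeps a large numeral out of later computations. The last bound says 8 B <=
    (16/5)^41. *)
Lemma cheb42_exp_leq : exists B,
  [/\ forall m, cheb42 m <= B ^ m, B <= 8 ^ 22 & B * 5 ^ 41 * 8 <= 16 ^ 41].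
Proof. by exists (2 ^ 22 * 3 ^ 15 * 7 ^ 7); split; [exact: cheb42_leq|lia|lia]. Qed.

(** B^(k+1) = B B^k <= (8 B)^k: the spare factor B is absorbed by 8^k, whence k >= 22. *)
Lemma cheb42_ratio k : 22 <= k -> cheb42 k.+1 * 5 ^ (41 * k) <= 16 ^ (41 * k).
Proof.
move=> le_k; have [B [/(_ k.+1) DB B8 B16]] := cheb42_exp_leq.
have Bk : B <= 8 ^ k by rewrite (leq_trans B8) // leq_pexp2l.
apply: leq_trans (leq_mul DB (leqnn _)) _; rewrite expnS -mulnA.
apply: leq_trans (leq_mul Bk (leqnn _)) _.
rewrite (expnM 5) (expnM 16) mulnC -!expnMn leq_exp2r //.
by apply: leq_trans le_k.
Qed.

Lemma lcm_upto_bound : exists C, forall n, lcm_upto n * 5 ^ n <= C * 16 ^ n.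
Proof.
exists (lcm_upto 966); elim/ltn_ind => n ih.
have le_exp r : 5 ^ r <= 16 ^ r by case: r => // r; rewrite leq_exp2r.
have [le_n|lt_n] := leqP n 966; first by rewrite leq_mul ?lcm_upto_leq.
(* k + 1 is n / 42 rounded up. Of the exponent n, the part k + 1 goes to the induction hypothesis,
   41 k to [cheb42_ratio], and r to 5^r <= 16^r. *)
pose k := n.-1 %/ 42; pose r := n.-1 %% 42.
have eq_n : n = k.+1 + (41 * k + r) by rewrite /k /r; lia.
have le_k : 22 <= k by rewrite /k; lia.
have lt_kn : k.+1 < n by lia.
have le_n42 : n <= 42 * k.+1 by rewrite /k; lia.
have leL : lcm_upto n <= cheb42 k.+1 * lcm_upto k.+1.
  apply: leq_trans (lcm_upto_leq le_n42) _.
  by rewrite dvdn_leq ?lcm_upto42_dvd // muln_gt0 cheb42_gt0 lcm_upto_gt0.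
apply: leq_trans (leq_mul leL (leqnn _)) _.
rewrite [in 5 ^ n]eq_n [in 16 ^ n]eq_n 2!(expnD _ k.+1) 2!(expnD _ (41 * k)).
have := leq_mul (ih _ lt_kn) (leq_mul (cheb42_ratio le_k) (le_exp r)).
have perm (a b c d e : nat) : a * b * (c * d * e) = c * a * (b * (d * e)) by ring.
by rewrite perm -[X in _ <= X -> _]mulnA.
Qed.

Local Open Scope ring_scope.

(** * Apery's sequences *)

Definition apery_h (n k : nat) : nat := 'C(n, k) * 'C(n + k, k).

Definition apery_b (n : nat) : nat := \sum_(k < n.+1) apery_h n k ^ 2.

(* For k > n the terms with m >= n vanish, as [apery_h n m.+1 = 0] and 1/0 = 0. *)
Definition apery_c (R : numFieldType) (n k : nat) : R :=
  \sum_(m < n) 1 / m.+1%:R ^+ 3 +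
  \sum_(m < k) (-1) ^+ m / (2 * m.+1%:R ^+ 3 * (apery_h n m.+1)%:R).

Definition apery_a (R : numFieldType) (n : nat) : R :=
  \sum_(k < n.+1) (apery_h n k)%:R ^+ 2 * apery_c R n k.

(** * Shift relations for h(n,k) *)

Lemma apery_h0 n : apery_h n 0 = 1%N.
Proof. by rewrite /apery_h !bin0. Qed.

Lemma apery_h_small n k : (n < k)%N -> apery_h n k = 0%N.
Proof. by move=> lt_nk; rewrite /apery_h bin_small. Qed.

Lemma apery_h_gt0 n k : (k <= n)%N -> (0 < apery_h n k)%N.
Proof. by move=> le_kn; rewrite /apery_h muln_gt0 !bin_gt0 le_kn leq_addl. Qed.

(** With d = n - k this is h(n,k) = (n+k)! / (k!^2 (n-k)!), free of truncated subtraction. *)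
Lemma apery_h_fact d k :
  (apery_h (d + k) k * (k`! ^ 2 * d`!) = (d + k + k)`!)%N.
Proof.
have e1 : ('C(d + k, k) * (k`! * d`!) = (d + k)`!)%N.
  by rewrite -(bin_fact (leq_addl d k)) addnK.
have e2 : ('C(d + k + k, k) * (k`! * (d + k)`!) = (d + k + k)`!)%N.
  by rewrite -(bin_fact (leq_addl (d + k) k)) addnK.
by rewrite -e2 -e1 /apery_h; ring.
Qed.

Lemma natr_fact_neq0 (R : numFieldType) n : n`!%:R != 0 :> R.
Proof. by rewrite pnatr_eq0 -lt0n fact_gt0. Qed.

Lemma apery_hE (R : numFieldType) d k :
  (apery_h (d + k) k)%:R = (d + k + k)`!%:R / (k`!%:R ^+ 2 * d`!%:R) :> R.
Proof.
by rewrite -apery_h_fact !natrM -expr2 mulfK.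
Qed.

(** This and the next three shift relations are in product form, so as to hold for every k: out of
    range both sides vanish. *)
Lemma apery_h_recr (R : numFieldType) n k :
  (apery_h n k.+1)%:R * (k%:R + 1) ^+ 2 =
  (apery_h n k)%:R * (n%:R - k%:R) * (n%:R + k%:R + 1) :> R.
Proof.
have [lt_nk|lt_kn|->] := ltngtP n k.
- by rewrite !apery_h_small ?mul0r // ltnW.
- have -> : n = (n - k.+1 + k.+1)%N by rewrite subnK.
  move: (n - k.+1)%N => d.
  have E1 := apery_hE R d k.+1; have E2 := apery_hE R d.+1 k.
  rewrite addSnnS in E2; rewrite E1 E2.
  have := natr_fact_neq0 R d; have := natr_fact_neq0 R k.
  have hd : d%:R + 1 != 0 :> R by rewrite natr1 pnatr_eq0.
  have hk : k%:R + 1 != 0 :> R by rewrite natr1 pnatr_eq0.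
  rewrite !addnS !factS !natrM -!natr1 !natrD => k0 d0.
  by field; rewrite ?k0 ?d0 ?hk ?hd.
- by rewrite apery_h_small // subrr mulr0 !mul0r.
Qed.

Lemma apery_h_recl (R : numFieldType) n k :
  (apery_h n.+1 k)%:R * (n%:R + 1 - k%:R) =
  (apery_h n k)%:R * (n%:R + 1 + k%:R) :> R.
Proof.
have [le_kn|lt_nk|->] := ltngtP k n.+1.
- have -> : n = (n - k + k)%N by rewrite subnK.
  move: (n - k)%N => d; rewrite apery_hE -addSn apery_hE.
  have := natr_fact_neq0 R d; have := natr_fact_neq0 R k.
  have hd : d%:R + 1 != 0 :> R by rewrite natr1 pnatr_eq0.
  rewrite !addSn !factS !natrM -!natr1 !natrD => k0 d0.
  by field; rewrite ?k0 ?d0 ?hd.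
- by rewrite !apery_h_small ?mul0r // ltnW.
- by rewrite (@apery_h_small n) // mul0r -natr1 subrr mulr0.
Qed.

Lemma apery_h_recd (R : numFieldType) n k :
  (apery_h n.+1 k.+1)%:R * (k%:R + 1) ^+ 2 =
  (apery_h n k)%:R * (n%:R + 1 + k%:R) * (n%:R + 2 + k%:R) :> R.
Proof. by rewrite apery_h_recr -apery_h_recl -natr1; ring. Qed.

Lemma apery_h_recu (R : numFieldType) n k :
  (apery_h n k.+1)%:R * (k%:R + 1) ^+ 2 =
  (apery_h n.+1 k)%:R * (n%:R + 1 - k%:R) * (n%:R - k%:R) :> R.
Proof. by rewrite apery_h_recr apery_h_recl; ring. Qed.

Lemma natr_addn1_neq0 (R : numFieldType) n : n%:R + 1 != 0 :> R.
Proof. by rewrite natr1 pnatr_eq0. Qed.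

(** * The recurrence for b_n *)

Definition apery_P (R : numFieldType) (n : nat) : R :=
  34 * n%:R ^+ 3 + 51 * n%:R ^+ 2 + 27 * n%:R + 5.

(* Telescoping certificate for the recurrence satisfied by [apery_b]. *)
Definition zagier_B (R : numFieldType) (n k : nat) : R :=
  4 * (2 * n%:R + 1) * (k%:R * (2 * k%:R + 1) - (2 * n%:R + 1) ^+ 2) *
  (apery_h n k)%:R ^+ 2.

(** Once every h is expressed through h(n+1,k), a rational identity in n and k remains. *)
Lemma zagier_B_rec (R : numFieldType) n k :
  n.+2%:R ^+ 3 * (apery_h n.+2 k.+1)%:R ^+ 2 -
  apery_P R n.+1 * (apery_h n.+1 k.+1)%:R ^+ 2 +
  n.+1%:R ^+ 3 * (apery_h n k.+1)%:R ^+ 2 =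
  zagier_B R n.+1 k.+1 - zagier_B R n.+1 k.
Proof.
have k0 : (k%:R + 1) ^+ 2 != 0 :> R by rewrite expf_neq0 ?natr_addn1_neq0.
have /(canRL (mulfK k0)) E2 := apery_h_recd R n.+1 k.
have /(canRL (mulfK k0)) E1 := apery_h_recr R n.+1 k.
have /(canRL (mulfK k0)) E0 := apery_h_recu R n k.
rewrite /zagier_B /apery_P E2 E1 E0 -!natr1.
by field; rewrite natr_addn1_neq0.
Qed.

(** The term k = 0 telescopes as if the certificate were 0 at k = -1. *)
Lemma zagier_B0 (R : numFieldType) n :
  n.+2%:R ^+ 3 - apery_P R n.+1 + n.+1%:R ^+ 3 = zagier_B R n.+1 0.
Proof. by rewrite /zagier_B /apery_P apery_h0 -!natr1; ring. Qed.

(** Terms beyond n vanish, so the sums for n, n + 1 and n + 2 can share one range. *)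
Lemma apery_bE (R : numFieldType) n N : (n <= N)%N ->
  (apery_b n)%:R = \sum_(k < N.+1) (apery_h n k)%:R ^+ 2 :> R.
Proof.
move=> le_nN; rewrite /apery_b natr_sum -(subnKC le_nN) -addSn big_split_ord /=.
rewrite [X in _ = _ + X]big1 ?addr0 => [|i _].
  by apply: eq_bigr => i _; rewrite natrX.
by rewrite apery_h_small ?expr0n // addSn ltnS leq_addr.
Qed.

Lemma apery_aE (R : numFieldType) n N : (n <= N)%N ->
  apery_a R n = \sum_(k < N.+1) (apery_h n k)%:R ^+ 2 * apery_c R n k.
Proof.
move=> le_nN; rewrite /apery_a -(subnKC le_nN) -addSn big_split_ord /=.
rewrite [X in _ = _ + X]big1 ?addr0 // => i _.
by rewrite apery_h_small ?expr0n ?mul0r // addSn ltnS leq_addr.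
Qed.

Lemma apery_b_rec (R : numFieldType) n :
  n.+2%:R ^+ 3 * (apery_b n.+2)%:R - apery_P R n.+1 * (apery_b n.+1)%:R +
  n.+1%:R ^+ 3 * (apery_b n)%:R = 0 :> R.
Proof.
rewrite (@apery_bE _ n.+2 n.+2) // (@apery_bE _ n.+1 n.+2) //.
rewrite (@apery_bE _ n n.+2); last by lia.
rewrite !mulr_sumr -sumrB -big_split /=.
rewrite big_ord_recl /= !apery_h0 !expr1n !mulr1 zagier_B0.
under eq_bigr => i _ do rewrite zagier_B_rec.
rewrite -(big_mkord xpredT (fun i => zagier_B R n.+1 i.+1 - zagier_B R n.+1 i)).
(* What survives is the certificate at k = n + 2, which contains h(n+1,n+2) = 0. *)
rewrite telescope_sumr // addrC subrK.
by rewrite /zagier_B apery_h_small // expr0n mulr0.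
Qed.

(** * Differences of c(n,k) and the recurrence for a_n *)

Lemma apery_cS (R : numFieldType) n k : (k < n)%N ->
  (apery_c R n k.+1 - apery_c R n k) *
  (2 * (k%:R + 1) ^+ 3 * (apery_h n k.+1)%:R) = (-1) ^+ k.
Proof.
move=> lt_kn; rewrite /apery_c big_ord_recr /=.
have h0 : (apery_h n k.+1)%:R != 0 :> R by rewrite pnatr_eq0 -lt0n apery_h_gt0.
rewrite -natr1; set s := (\sum_(m < n) _); set t := (\sum_(m < k) _).
by field; rewrite h0 nat1r pnatr_eq0.
Qed.

(** The difference is (-1)^k k!^2 (n-k)! / ((n+1)^2 (n+k+1)!), by induction on k from the value
    1/(n+1)^3 at k = 0. *)
Lemma apery_c_shift (R : numFieldType) n k : (k <= n)%N ->
  (apery_c R n.+1 k - apery_c R n k) *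
  ((apery_h n k)%:R * (n%:R + 1) ^+ 2 * (n%:R + 1 + k%:R)) = (-1) ^+ k.
Proof.
elim: k => [_|k ih lt_kn].
  rewrite /apery_c !big_ord0 big_ord_recr /= apery_h0 -natr1.
  set s := (\sum_(m < n) _).
  by field; rewrite natr_addn1_neq0.
have h0 : (apery_h n k)%:R != 0 :> R by rewrite pnatr_eq0 -lt0n apery_h_gt0 // ltnW.
have k1 := natr_addn1_neq0 R k; have n1 := natr_addn1_neq0 R n.
have nk0 : n%:R - k%:R != 0 :> R by rewrite subr_eq0 eqr_nat gtn_eqF.
have nk1 : n%:R + 1 + k%:R != 0 :> R by rewrite addrAC -natrD natr_addn1_neq0.
have nk2 : n%:R + 2 + k%:R != 0 :> R by rewrite addrAC -!natrD pnatr_eq0 addnS.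
have k0 : (k%:R + 1) ^+ 2 != 0 :> R by rewrite expf_neq0 ?natr_addn1_neq0.
have /(canRL (mulfK k0)) E2 := apery_h_recd R n k.
have /(canRL (mulfK k0)) E1 := apery_h_recr R n k.
have := ih (ltnW lt_kn); have := @apery_cS R n k lt_kn.
have := @apery_cS R n.+1 k (ltnW lt_kn).
rewrite E1 E2 [(-1) ^+ k.+1]exprS -[k.+1%:R]natr1.
move: (apery_c R n.+1 k.+1) (apery_c R n.+1 k) => x' x.
move: (apery_c R n k.+1) (apery_c R n k) ((-1) ^+ k) => y' y s.
move: (apery_h n k)%:R h0 => h h0.
have c0 : 2 * (k%:R + 1) ^+ 3 != 0 :> R by rewrite mulf_neq0 ?expf_neq0 // pnatr_eq0.
have h1 : h * (n%:R - k%:R) * (n%:R + k%:R + 1) / (k%:R + 1) ^+ 2 != 0.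
  by rewrite !mulf_neq0 ?invr_neq0 // addrAC.
have h2 : h * (n%:R + 1 + k%:R) * (n%:R + 2 + k%:R) / (k%:R + 1) ^+ 2 != 0.
  by rewrite !mulf_neq0 ?invr_neq0.
have h3 : h * (n%:R + 1) ^+ 2 * (n%:R + 1 + k%:R) != 0.
  by rewrite !mulf_neq0 ?expf_neq0.
move=> /(canRL (mulfK (mulf_neq0 c0 h2)))/eqP; rewrite subr_eq => /eqP ->.
move=> /(canRL (mulfK (mulf_neq0 c0 h1)))/eqP; rewrite subr_eq => /eqP ->.
move=> /(canRL (mulfK h3))/eqP; rewrite subr_eq => /eqP ->.
by field; rewrite k1 nk0 h0 n1 nk2 addrAC nk1.
Qed.

(* Telescoping certificate for the recurrence satisfied by [apery_a]. *)
Definition zagier_A (R : numFieldType) (n k : nat) : R :=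
  zagier_B R n k * apery_c R n k -
  5 * (2 * n%:R + 1) * (-1) ^+ k * k%:R / (n%:R * (n%:R + 1)) * (apery_h n k)%:R.

Lemma zagier_A0 (R : numFieldType) n :
  n.+2%:R ^+ 3 * apery_c R n.+2 0 - apery_P R n.+1 * apery_c R n.+1 0 +
  n.+1%:R ^+ 3 * apery_c R n 0 = zagier_A R n.+1 0.
Proof.
rewrite /zagier_A /= -zagier_B0 /apery_c !big_ord0 !big_ord_recr /=.
move: (\sum_(_ < n) _) => s; rewrite /apery_P.
have n1 := natr_addn1_neq0 R n; have n2 := natr_addn1_neq0 R n.+1.
rewrite -[n.+2%:R]natr1 -![n.+1%:R]natr1 in n2 *.
by field; rewrite n1 n2.
Qed.

(** The factor h(n,k)^2 extends the shift formula to k > n, where both sides vanish; the sum in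
    [apery_a_rec] reaches such k. *)
Lemma apery_c_shift_sqr (R : numFieldType) n k :
  (apery_h n k)%:R ^+ 2 * apery_c R n k = (apery_h n k)%:R ^+ 2 * apery_c R n.+1 k -
  (apery_h n k)%:R * (-1) ^+ k / ((n%:R + 1) ^+ 2 * (n%:R + 1 + k%:R)).
Proof.
have [le_kn|lt_nk] := leqP k n; last by rewrite apery_h_small // expr0n !mul0r subrr.
have n1 := natr_addn1_neq0 R n.
have nk1 : n%:R + 1 + k%:R != 0 :> R by rewrite addrAC -natrD natr_addn1_neq0.
rewrite -(apery_c_shift R le_kn).
by field; rewrite n1 nk1.
Qed.

Lemma apery_cS_sqr (R : numFieldType) n k :
  (apery_h n k.+1)%:R ^+ 2 * apery_c R n k.+1 = (apery_h n k.+1)%:R ^+ 2 * apery_c R n k +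
  (apery_h n k.+1)%:R * (-1) ^+ k / (2 * (k%:R + 1) ^+ 3).
Proof.
have [lt_kn|le_nk] := ltnP k n; last by rewrite apery_h_small // expr0n !mul0r addr0.
have k1 := natr_addn1_neq0 R k.
rewrite -(apery_cS R lt_kn).
by field; rewrite k1.
Qed.

Lemma zagier_A_rec (R : numFieldType) n k : (k <= n.+1)%N ->
  n.+2%:R ^+ 3 * ((apery_h n.+2 k.+1)%:R ^+ 2 * apery_c R n.+2 k.+1) -
  apery_P R n.+1 * ((apery_h n.+1 k.+1)%:R ^+ 2 * apery_c R n.+1 k.+1) +
  n.+1%:R ^+ 3 * ((apery_h n k.+1)%:R ^+ 2 * apery_c R n k.+1) =
  zagier_A R n.+1 k.+1 - zagier_A R n.+1 k.
Proof.
move=> le_kn.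
have h0 : (apery_h n.+1 k)%:R != 0 :> R by rewrite pnatr_eq0 -lt0n apery_h_gt0.
have k1 := natr_addn1_neq0 R k; have n1 := natr_addn1_neq0 R n.
have n2 : n%:R + 2 != 0 :> R by rewrite -natrD pnatr_eq0 addn2.
have nk2 : n%:R + 2 + k%:R != 0 :> R by rewrite addrAC -!natrD pnatr_eq0 addn2.
have k0 : (k%:R + 1) ^+ 2 != 0 :> R by rewrite expf_neq0 ?natr_addn1_neq0.
have e1 : n.+1%:R = n%:R + 1 :> R by rewrite natr1.
have e2 : n.+2%:R = n%:R + 2 :> R by rewrite -natrD addn2.
have ek : k.+1%:R = k%:R + 1 :> R by rewrite natr1.
have /(canRL (mulfK k0)) E2 := apery_h_recd R n.+1 k.
have /(canRL (mulfK k0)) E1 := apery_h_recr R n.+1 k.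
have /(canRL (mulfK k0)) E0 := apery_h_recu R n k.
(* The value of c at n + 2 is brought down to c(n+1,k), the one at n up to c(n+1,k+1); C1 links
   these two. *)
have C2 := apery_cS_sqr R n.+2 k; have C1 := apery_cS_sqr R n.+1 k.
have C0 := apery_c_shift_sqr R n k.+1.
have h3 : (apery_h n.+1 k)%:R * (n.+1%:R + 1) ^+ 2 * (n.+1%:R + 1 + k%:R) != 0 :> R.
  by rewrite natr1 e2 !mulf_neq0 ?expf_neq0.
have := apery_c_shift R le_kn => /(canRL (mulfK h3))/eqP; rewrite subr_eq => /eqP D.
rewrite C2 C0 D /zagier_A /zagier_B /apery_P.
move: C1; rewrite E2 E1 E0 [(-1) ^+ k.+1]exprS ek e1 e2.
move: (apery_c R n.+1 k.+1) (apery_c R n.+1 k) ((-1) ^+ k) => c1 c0 s.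
move: (apery_h n.+1 k)%:R h0 => g g0 C1.
apply/eqP; rewrite -subr_eq0; apply/eqP.
(* The difference of the two sides is [gam] times that of the two sides of C1;
   solving C1 for c1 instead would divide by h(n+1,k+1), which is 0 for k = n+1. *)
set gam := - (34 * (n%:R + 1) ^+ 3 + 51 * (n%:R + 1) ^+ 2 + 27 * (n%:R + 1) + 5) +
  (n%:R + 1) ^+ 3 * ((n%:R - k%:R) / (n%:R + 2 + k%:R)) ^+ 2 -
  4 * (2 * (n%:R + 1) + 1) *
    ((k%:R + 1) * (2 * (k%:R + 1) + 1) - (2 * (n%:R + 1) + 1) ^+ 2) : R.
transitivity (gam * 0); last by rewrite mulr0.
move/eqP: C1; rewrite -subr_eq0 => /eqP <-.
rewrite /gam; field.
by rewrite k1 nk2 n1 g0 -addrA n2.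
Qed.

Lemma apery_a_rec (R : numFieldType) n :
  n.+2%:R ^+ 3 * apery_a R n.+2 - apery_P R n.+1 * apery_a R n.+1 +
  n.+1%:R ^+ 3 * apery_a R n = 0.
Proof.
rewrite (@apery_aE _ n.+2 n.+2) // (@apery_aE _ n.+1 n.+2) //.
rewrite (@apery_aE _ n n.+2); last by lia.
rewrite !mulr_sumr -sumrB -big_split /=.
rewrite big_ord_recl /= !apery_h0 !expr1n !mul1r zagier_A0.
rewrite (eq_bigr (fun i : 'I_n.+2 => zagier_A R n.+1 i.+1 - zagier_A R n.+1 i)); last first.
  by move=> i _; rewrite zagier_A_rec // -ltnS.
rewrite -(big_mkord xpredT (fun i => zagier_A R n.+1 i.+1 - zagier_A R n.+1 i)).
rewrite telescope_sumr // addrC subrK.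
by rewrite /zagier_A /zagier_B apery_h_small // expr0n !(mulr0, mul0r) subrr.
Qed.

(** * The Casoratian and the growth of b_n *)

(** Eliminating the middle terms of the two recurrences gives (n+2)^3 W(n+1) = (n+1)^3 W(n) for the
    left side W, and W(0) = 6. *)
Lemma apery_casoratian (R : numFieldType) n :
  apery_a R n.+1 * (apery_b n)%:R - apery_a R n * (apery_b n.+1)%:R =
  6 / n.+1%:R ^+ 3 :> R.
Proof.
elim: n => [|n ih].
  rewrite /apery_a /apery_b !big_ord_recr !big_ord0 /= /apery_c !big_ord_recr !big_ord0 /=.
  rewrite !apery_h0 (_ : apery_h 1 1 = 2%N) //.
  by field.
have n3 k : k.+1%:R ^+ 3 != 0 :> R by rewrite expf_neq0 // pnatr_eq0.
apply: (mulfI (n3 n.+1)); rewrite [RHS]mulrC divfK //.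
rewrite -[RHS](divfK (n3 n)) -ih.
have /eqP := apery_a_rec R n; rewrite -[X in X == _]addrA addr_eq0 => /eqP A.
have /eqP := apery_b_rec R n; rewrite -[X in X == _]addrA addr_eq0 => /eqP B.
rewrite mulrBr [in X in X - _]mulrA [in X in _ - X]mulrCA A B.
by ring.
Qed.

Lemma apery_b_gt0 n : (0 < apery_b n)%N.
Proof. by rewrite /apery_b big_ord_recl apery_h0. Qed.

Lemma apery_b_leq n : (apery_b n <= apery_b n.+1)%N.
Proof.
rewrite /apery_b [X in (_ <= X)%N]big_ord_recr /=; apply: leq_trans (leq_addr _ _).
apply: leq_sum => k _; rewrite leq_exp2r //; apply: leq_mul; first exact: leq_bin2l.
by rewrite addSn leq_bin2l.
Qed.

(* The recurrence first gives the ratio 32, and then 34 - 1/32 up to O(1/n). *)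
Lemma apery_b_ratio n : (60 <= n)%N -> (33 * apery_b n.+1 <= apery_b n.+2)%N.
Proof.
have rec m : (m.+2 ^ 3 * apery_b m.+2 + m.+1 ^ 3 * apery_b m =
    (34 * m.+1 ^ 3 + 51 * m.+1 ^ 2 + 27 * m.+1 + 5) * apery_b m.+1)%N.
  apply/eqP; rewrite -(eqr_nat rat) natrD !natrM !natrD !natrM.
  by rewrite -subr_eq0 -(apery_b_rec rat m) /apery_P; apply/eqP; ring.
(* Monotonicity bounds the oldest term of the recurrence, so the ratio is about 34 - 1 at least,
   hence 32 from 60 on. *)
have b32 m : (60 <= m)%N -> (32 * apery_b m <= apery_b m.+1)%N.
  case: m => // m le_m; have := rec m; have := apery_b_leq m.
  move: (apery_b m) (apery_b m.+1) (apery_b m.+2) => x y z le_xy eqz.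
  rewrite -(@leq_pmul2l (m.+2 ^ 3)) ?expn_gt0 // -(leq_add2r (m.+1 ^ 3 * x)) eqz.
  apply: (@leq_trans ((32 * m.+2 ^ 3 + m.+1 ^ 3) * y)).
    by rewrite mulnDl mulnCA mulnA leq_add2l leq_mul.
  by rewrite leq_mul //; nia.
move=> le_n; have := rec n; have := b32 n le_n.
move: (apery_b n) (apery_b n.+1) (apery_b n.+2) => x y z le_xy eqz.
rewrite -(@leq_pmul2l (32 * n.+2 ^ 3)) ?muln_gt0 ?expn_gt0 //.
rewrite -(leq_add2r (n.+1 ^ 3 * (32 * x))).
have -> : (32 * n.+2 ^ 3 * z + n.+1 ^ 3 * (32 * x) =
    32 * (34 * n.+1 ^ 3 + 51 * n.+1 ^ 2 + 27 * n.+1 + 5) * y)%N.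
  by rewrite -mulnA -[in RHS]mulnA -eqz; ring.
apply: (@leq_trans ((32 * n.+2 ^ 3 * 33 + n.+1 ^ 3) * y)).
  by rewrite mulnDl mulnA leq_add2l leq_mul.
by rewrite leq_mul //; nia.
Qed.

Lemma apery_b_growth n : (33 ^ n <= apery_b (61 + n))%N.
Proof.
elim: n => [|n ih]; first exact: apery_b_gt0.
by rewrite expnS addnS (leq_trans _ (apery_b_ratio _)) ?leq_mul // leq_addr.
Qed.

(** * Integrality of 2 L_n^3 a_n *)

(* The numbers 1 / (m C(n,m)) form Leibniz's harmonic triangle. *)
Lemma lcm_upto_bin (R : archiRealFieldType) N n m : (m < n <= N)%N ->
  (lcm_upto N)%:R / (m.+1 * 'C(n, m.+1))%:R \is a @Num.int R.
Proof.
elim: m n => [|m ih] n /andP[lt_mn le_nN].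
  rewrite mul1n bin1 -(divnK (@dvdn_lcm_upto n N _)) ?lt_mn // natrM mulfK ?natr_int //.
  by rewrite pnatr_eq0; lia.
case: n lt_mn le_nN => // n lt_mn le_nN.
have := rpredB (ih n _) (ih n.+1 _); rewrite -mulrBr => H.
(* An entry of the triangle is a difference of two entries with smaller m, so integrality passes
   along the induction. *)
suff -> : (m.+2 * 'C(n.+1, m.+2))%:R^-1 = 
   (m.+1 * 'C(n, m.+1))%:R^-1 - (m.+1 * 'C(n.+1, m.+1))%:R^-1 :> R.
  by apply: H; lia.
have /(congr1 (fun i => i%:R : R)) := mul_bin_diag n.+1 m.+1.
have /(congr1 (fun i => i%:R : R)) := mul_bin_down n.+1 m.+1.
rewrite /= subSS => e1 e2; rewrite -{}e2; move: e1; rewrite !natrM.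
have x0 : 'C(n, m.+1)%:R != 0 :> R by rewrite pnatr_eq0 -lt0n bin_gt0.
have y0 : 'C(n.+1, m.+1)%:R != 0 :> R by rewrite pnatr_eq0 -lt0n bin_gt0 leqW.
have d0 : (n - m)%:R != 0 :> R by rewrite pnatr_eq0 subn_eq0 -ltnNge.
move=> /esym/(canRL (mulKf d0)) ->; rewrite natrB in d0 *; last exact: ltnW.
have := natr_addn1_neq0 R n; have := natr_addn1_neq0 R m; rewrite !natr1 => n1 m1.
rewrite -[m.+1%:R]natr1 -[n.+1%:R]natr1 in n1 m1 *.
by field; rewrite d0 x0 n1 m1.
Qed.


(** Both sides are the trinomial coefficient (n+k)! / (n! m! (k-m)!). *)
Lemma bin_trinomial n k m : (m <= k)%N ->
  ('C(n + k, k) * 'C(k, m) = 'C(n + k, k - m) * 'C(n + m, m))%N.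
Proof.
move=> le_mk.
have e1 := bin_fact (leq_addl n k); rewrite addnK in e1.
have e2 := bin_fact le_mk.
have le_d : (k - m <= n + k)%N by rewrite (leq_trans (leq_subr _ _)) ?leq_addl.
have e3 := bin_fact le_d; rewrite subnBA // [(n + k + m)%N]addnAC addnK in e3.
have e4 := bin_fact (leq_addl n m); rewrite addnK in e4.
apply/eqP; rewrite -(@eqn_pmul2r (m`! * (k - m)`! * n`!)) ?muln_gt0 ?fact_gt0 //; apply/eqP.
transitivity ((n + k)`!); first by rewrite -e1 -e2; ring.
by rewrite -e3 -e4; ring.
Qed.

(** In the correction terms [bin_trinomial] trades C(n+m,m) in the denominator for C(k,m); L^3 /
    (m^3 C(n,m) C(k,m)) then splits into three integers L/m, L/(m C(n,m)) and L/(m C(k,m)). *)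
Lemma apery_a_int (R : archiRealFieldType) n :
  2 * (lcm_upto n)%:R ^+ 3 * apery_a R n \is a Num.int.
Proof.
set L : R := (lcm_upto n)%:R.
have Lm m : (m < n)%N -> L / m.+1%:R \is a Num.int.
  by move=> lt_mn; have := @lcm_upto_bin R n m.+1 m; rewrite binn muln1 => ->; lia.
rewrite /apery_a mulr_sumr rpred_sum // => k _.
rewrite /apery_c mulrDr mulrDr rpredD //.
  rewrite [(apery_h _ _)%:R ^+ 2 * _]mulrC mulrA rpredM ?rpredX ?natr_int //.
  rewrite mulr_sumr rpred_sum // => m _.
  have -> : 2 * L ^+ 3 * (1 / m.+1%:R ^+ 3) = 2 * (L / m.+1%:R) ^+ 3.
    by field; rewrite nat1r pnatr_eq0.
  by rewrite rpredM ?rpredX ?natr_int ?Lm.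
rewrite expr2 !mulrA !mulr_sumr rpred_sum // => m _.
have le_kn : (k <= n)%N by rewrite -ltnS.
have lt_mk := ltn_ord m; have lt_mn : (m < n)%N by lia.
have : L / m.+1%:R * (L / (m.+1 * 'C(n, m.+1))%:R) *
    (L / (m.+1 * 'C(k, m.+1))%:R) \is a Num.int.
  apply: rpredM; last by apply: lcm_upto_bin; lia.
  by apply: rpredM; [exact: Lm|apply: lcm_upto_bin; lia].
have /(congr1 (fun i => i%:R : R)) := bin_trinomial n lt_mk.
rewrite /apery_h !natrM.
have nm0 : 'C(n, m.+1)%:R != 0 :> R by rewrite pnatr_eq0 -lt0n bin_gt0.
have km0 : 'C(k, m.+1)%:R != 0 :> R by rewrite pnatr_eq0 -lt0n bin_gt0.
have nmm0 : 'C(n + m.+1, m.+1)%:R != 0 :> R by rewrite pnatr_eq0 -lt0n bin_gt0 leq_addl.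
move=> /esym/(canRL (mulfK nmm0)) eX Lint.
have := natr_addn1_neq0 R m; rewrite natr1 => m1.
set goal := (X in X \in _).
have -> : goal = L / m.+1%:R * (L / (m.+1%:R * 'C(n, m.+1)%:R)) *
    (L / (m.+1%:R * 'C(k, m.+1)%:R)) *
    ('C(n, k)%:R ^+ 2 * 'C(n + k, k)%:R * 'C(n + k, k - m.+1)%:R * (-1) ^+ m).
  rewrite eX /goal; set s := (-1) ^+ m; field.
  by rewrite nm0 nmm0 km0 nat1r pnatr_eq0.
by rewrite rpredM // !rpredM ?rpredX ?natr_int // rpredN1.
Qed.

(** * Approximation of zeta(3) *)

Local Open Scope classical_set_scope.

(** h(n,k+1) >= C(n+k+1,k+1) = C(n+k+1,n) >= C(n+1,n) = n + 1. *)
Lemma apery_h_ge n k : (k < n)%N -> (n < apery_h n k.+1)%N.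
Proof.
move=> lt_kn; rewrite /apery_h -[X in (X <= _)%N]mul1n leq_mul ?bin_gt0 //.
rewrite -(bin_sub (leq_addl n k.+1)) addnK -[X in (X <= _)%N]binSn.
by rewrite leq_bin2l // addnS ltnS leq_addr.
Qed.

Definition harmonic3 (R : numFieldType) (n : nat) : R :=
  \sum_(m < n) 1 / m.+1%:R ^+ 3.

(** By [apery_h_ge], each correction term is at most 1/(m+1)^3 times 1/(n+1) in absolute value. *)
Lemma apery_c_near (R : numFieldType) n k : (k <= n)%N ->
  `|apery_c R n k - harmonic3 R n| <= harmonic3 R n / n.+1%:R.
Proof.
move=> le_kn; rewrite /apery_c /harmonic3 addrAC subrr add0r.
apply: le_trans (ler_norm_sum _ _ _) _.
rewrite mulr_suml -(subnKC le_kn) big_split_ord /=; apply: ler_wpDr.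
  by apply: sumr_ge0 => m _; rewrite !divr_ge0 ?exprn_ge0.
apply: ler_sum => m _; rewrite normrM normrX normrN1 expr1n !mul1r subnKC //.
rewrite ger0_norm ?invr_ge0 ?mulr_ge0 ?exprn_ge0 //.
rewrite -invfM lef_pV2 ?posrE ?mulr_gt0 ?exprn_gt0 ?ltr0n ?apery_h_gt0 //; last first.
  by rewrite (leq_trans (ltn_ord m)).
rewrite ler_pM ?exprn_ge0 ?ler_peMl ?ler1n ?exprn_ge0 // ler_nat.
by rewrite apery_h_ge // (leq_trans (ltn_ord m)).
Qed.

Definition apery_ratio (R : numFieldType) (n : nat) : R :=
  apery_a R n / (apery_b n)%:R.

Lemma natr_apery_b_gt0 (R : numFieldType) n : 0 < (apery_b n)%:R :> R.
Proof. by rewrite ltr0n apery_b_gt0. Qed.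

(** a_n / b_n is the mean of the c(n,k) with weights h(n,k)^2, so it inherits their common bound. *)
Lemma apery_ratio_near (R : numFieldType) n :
  `|apery_ratio R n - harmonic3 R n| <= harmonic3 R n / n.+1%:R.
Proof.
have b0 := natr_apery_b_gt0 R n.
rewrite -(ler_pM2r b0) -{1}(gtr0_norm b0) -normrM mulrBl divfK ?gt_eqF //.
rewrite (apery_bE R (leqnn n)) /apery_a !mulr_sumr -sumrB.
apply: le_trans (ler_norm_sum _ _ _) _; apply: ler_sum => k _.
rewrite [_ * _ ^+ 2]mulrC -mulrBr normrM ger0_norm ?exprn_ge0 // [X in _ <= X]mulrC.
by rewrite ler_wpM2l ?exprn_ge0 // apery_c_near // -ltnS.
Qed.

Lemma apery_ratioS (R : numFieldType) n :
  apery_ratio R n.+1 - apery_ratio R n =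
  6 / (n.+1%:R ^+ 3 * (apery_b n)%:R * (apery_b n.+1)%:R).
Proof.
have b0 := lt0r_neq0 (natr_apery_b_gt0 R n).
have b1 := lt0r_neq0 (natr_apery_b_gt0 R n.+1).
rewrite -[in RHS]mulrA [in RHS]invfM [in RHS]mulrA -apery_casoratian /apery_ratio.
by field; rewrite b0 b1.
Qed.

Lemma apery_ratio_lt (R : numFieldType) n : apery_ratio R n < apery_ratio R n.+1.
Proof.
rewrite -subr_gt0 apery_ratioS divr_gt0 //.
by rewrite !mulr_gt0 ?exprn_gt0 ?natr_apery_b_gt0.
Qed.

Lemma apery_ratio_leq (R : realFieldType) m n :
  (m <= n)%N -> apery_ratio R m <= apery_ratio R n.
Proof.
move: m n; apply: (homo_leq (r := fun x y => x <= y)) => [x|y x z|k] //.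
  exact: le_trans.
by rewrite ltW // apery_ratio_lt.
Qed.

Lemma apery_b_homo : {homo apery_b : m n / (m <= n)%N}.
Proof.
by apply: (homo_leq (r := leq)) => // [y x z|k]; [exact: leq_trans|exact: apery_b_leq].
Qed.

Lemma harmonic3S (R : numFieldType) n :
  harmonic3 R n.+1 = harmonic3 R n + 1 / n.+1%:R ^+ 3.
Proof. by rewrite /harmonic3 big_ord_recr. Qed.

(** For m >= n the increment 6 / ((m+1)^3 b_m b_(m+1)) is at most 6 / b_n^2 times the increment of
    [harmonic3]. *)
Lemma apery_ratio_gap (R : numFieldType) n d :
  apery_ratio R (n + d) - apery_ratio R n <=
  6 / (apery_b n)%:R ^+ 2 * (harmonic3 R (n + d) - harmonic3 R n).
Proof.
elim: d => [|d ih]; first by rewrite addn0 !subrr mulr0.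
rewrite addnS harmonic3S -[X in X - _](subrK (apery_ratio R (n + d))) -addrA.
rewrite [X in _ <= _ * X]addrAC mulrDr [X in _ <= X]addrC lerD // apery_ratioS.
rewrite -mulrA div1r [X in _ <= X]mulrAC -[X in _ <= X]mulrA -invfM ler_pM2l //.
have b0 := natr_apery_b_gt0 R.
rewrite lef_pV2 ?posrE ?mulr_gt0 ?exprn_gt0 // ler_wpM2l ?exprn_ge0 // expr2.
by rewrite ler_pM // ler_nat apery_b_homo ?leq_addr // leqW ?leq_addr.
Qed.

Lemma cvg_harmonic3 (R : realType) : harmonic3 R @ \oo --> zeta (3 : R).
Proof.
rewrite (_ : harmonic3 R = series (fun n => 1 / n.+1%:R ^+ 3)); first exact: cvg_zeta3.
by apply/funext => n; rewrite /series /harmonic3 /= big_mkord.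
Qed.

Lemma harmonic3_le_zeta (R : realType) n : harmonic3 R n <= zeta (3 : R).
Proof.
rewrite -(cvg_lim _ (@cvg_harmonic3 R)) //; apply: nondecreasing_cvgn_le.
  by apply/nondecreasing_seqP => k; rewrite harmonic3S lerDl divr_ge0 ?exprn_ge0.
by apply: cvgP (@cvg_harmonic3 R).
Qed.

Lemma cvg_apery_ratio (R : realType) : apery_ratio R @ \oo --> zeta (3 : R).
Proof.
have d0 : (fun n => apery_ratio R n - harmonic3 R n) @ \oo --> (0 : R).
  have h0 : (fun n => zeta (3 : R) * harmonic n) @ \oo --> (0 : R).
    by rewrite -[X in _ --> X](mulr0 (zeta (3 : R))); apply: cvgMr; exact: cvg_harmonic.
  apply: norm_cvg0; apply: (squeeze_cvgr _ (cvg_cst 0) h0).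
  apply: nearW => n; rewrite normr_ge0 /=.
  apply: le_trans (apery_ratio_near _ _) _.
  by rewrite ler_wpM2r ?invr_ge0 // harmonic3_le_zeta.
rewrite -[X in _ --> X]add0r (_ : apery_ratio R =
  (fun n => apery_ratio R n - harmonic3 R n) \+ harmonic3 R).
  exact: cvgD d0 (@cvg_harmonic3 R).
by apply/funext => n; rewrite /= subrK.
Qed.

Lemma zeta3_apery_bounds (R : realType) n :
  0 < (apery_b n)%:R * zeta (3 : R) - apery_a R n <= 6 * zeta 3 / (apery_b n)%:R.
Proof.
have b0 := natr_apery_b_gt0 R n.
have -> : (apery_b n)%:R * zeta (3 : R) - apery_a R n =
    (apery_b n)%:R * (zeta 3 - apery_ratio R n).
  by rewrite mulrBr /apery_ratio [_ * (_ / _)]mulrC divfK ?gt_eqF.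
(* Starting from the ratio at n + 1 keeps the lower bound strict after the passage to the limit. *)
have ratio_le m : (n < m)%N -> apery_ratio R n.+1 <= apery_ratio R m.
  exact: apery_ratio_leq.
apply/andP; split.
  rewrite mulr_gt0 // subr_gt0 (lt_le_trans (apery_ratio_lt R n)) //.
  rewrite -(cvg_lim _ (@cvg_apery_ratio R)) //; apply: limr_ge.
    exact: cvgP (@cvg_apery_ratio R).
  by exists n.+1 => // m /= /ratio_le.
rewrite [6 * _ / _](_ : _ =
    (apery_b n)%:R * (6 * zeta 3 / (apery_b n)%:R ^+ 2)); last first.
  by field; rewrite gt_eqF.
rewrite ler_pM2l // lerBlDl.
rewrite -{1}(cvg_lim _ (@cvg_apery_ratio R)) //; apply: limr_le.
  exact: cvgP (@cvg_apery_ratio R).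
exists n => // m /= le_nm; rewrite -lerBlDl -(subnKC le_nm).
apply: le_trans (apery_ratio_gap R n (m - n)) _.
rewrite [X in _ <= X]mulrAC; apply: ler_wpM2l; first by rewrite divr_ge0 ?exprn_ge0.
have h0 : 0 <= harmonic3 R n by apply: sumr_ge0 => i _; rewrite divr_ge0 ?exprn_ge0.
by rewrite lerBlDr (le_trans (harmonic3_le_zeta R _)) // lerDl.
Qed.

(** * Irrationality of zeta(3) *)

Lemma geometric_lt1 (R : archiRealFieldType) (K z : R) :
  `|z| < 1 -> exists n, K * z ^+ n < 1.
Proof.
move=> z1; have : (fun n => K * z ^+ n) @ \oo --> (0 : R).
  by rewrite -[X in _ --> X](mulr0 K); apply: cvgMl_tmp; exact: cvg_expr.
move/cvgrPdist_lt => /(_ 1 ltr01) [n _ zn]; exists n.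
have := zn n (leqnn n); rewrite /= sub0r normrN; apply: le_lt_trans; exact: ler_norm.
Qed.

Lemma int_gt0_ge1 (R : archiRealFieldType) (x : R) :
  x \is a Num.int -> 0 < x -> 1 <= x.
Proof. by move=> /intrP[m ->]; rewrite ltr0z gtz0_ge1 ler1z. Qed.

(** 4096/125 = (16/5)^3 = 32.768 lies just below 33, the growth rate available for b_n. *)
Lemma lcm_upto_cube (R : realFieldType) :
  exists2 K : R, 0 <= K & forall n, (lcm_upto n)%:R ^+ 3 <= K * (4096 / 125) ^+ n.
Proof.
have [C LC] := lcm_upto_bound; exists (C%:R ^+ 3); first by rewrite exprn_ge0.
move=> n; have -> : 4096 / 125 = (16 / 5) ^+ 3 :> R by field.
rewrite exprAC -exprMn lerXn2r ?nnegrE ?mulr_ge0 ?exprn_ge0 ?divr_ge0 //.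
rewrite expr_div_n mulrA ler_pdivlMr ?exprn_gt0 //.
by have := LC n; rewrite -(ler_nat R) !natrM !natrX.
Qed.

Theorem theorem2p5 (R : realType) : irrational (zeta (3 : R)).
Proof.
case=> q _ qE.
have [C C0 LC] := lcm_upto_cube R.
have D0 : 0 < (denq q)%:~R :> R by rewrite ltr0z denq_gt0.
have z0 : 0 <= zeta (3 : R) by have := harmonic3_le_zeta R 0; rewrite /harmonic3 big_ord0.
have zD : zeta (3 : R) * (denq q)%:~R \is a Num.int.
  by rewrite -qE divfK ?gt_eqF ?intr_int.
(* 12 = 2 * 6, and the power 61 comes from the shift in [apery_b_growth]; 4096/4125 is 4096/125
   divided by 33. *)
pose K := 12 * (denq q)%:~R * zeta (3 : R) * C * (4096 / 125) ^+ 61.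
have [|n] := @geometric_lt1 R K (4096 / 4125); first by rewrite ger0_norm; lra.
apply/negP; rewrite -leNgt.
have /andP[gt0 le] := zeta3_apery_bounds R (61 + n).
set N := (61 + n)%N in gt0 le *.
have L0 : 0 < (lcm_upto N)%:R :> R by rewrite ltr0n lcm_upto_gt0.
(* This product is a positive integer: [denq q] clears zeta(3) and 2 L^3 clears a_N. *)
have : 1 <= 2 * (lcm_upto N)%:R ^+ 3 * (denq q)%:~R *
    ((apery_b N)%:R * zeta (3 : R) - apery_a R N).
  apply: int_gt0_ge1; last by rewrite !mulr_gt0 ?exprn_gt0.
  have E (l d b z a : R) :
    2 * l * d * (b * z - a) = 2 * l * b * (z * d) - d * (2 * l * a) by ring.
  rewrite E.
  apply: rpredB; apply: rpredM; rewrite ?zD ?apery_a_int ?intr_int //.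
  by rewrite !rpredM ?rpredX ?natr_int.
move/le_trans; apply.
have b33 : 33 ^+ n <= (apery_b N)%:R :> R by rewrite -natrX ler_nat apery_b_growth.
apply: (@le_trans _ _
  (2 * (C * (4096 / 125) ^+ N) * (denq q)%:~R * (6 * zeta 3 / 33 ^+ n))).
  rewrite ler_pM ?mulr_ge0 ?exprn_ge0 ?(ltW gt0) ?(ltW D0) //.
    by rewrite ler_pM2r // ler_pM2l.
  apply: le_trans le _; rewrite ler_wpM2l ?mulr_ge0 //.
  by rewrite lef_pV2 ?posrE ?exprn_gt0 ?natr_apery_b_gt0.
rewrite le_eqVlt; apply/orP; left; apply/eqP.
rewrite /K /N exprD [(4096 / 4125) ^+ n](_ : _ = (4096 / 125) ^+ n / 33 ^+ n); last first.
  by rewrite -expr_div_n; congr (_ ^+ n); field.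
have E (c p x d z w : R) :
    2 * (c * (p * x)) * d * (6 * z * w) = 12 * d * z * c * p * (x * w).
  by ring.
by rewrite E.
Qed.
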